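(* Let $f$ be a social choice function and let $\mathcal{S}=(R,E)$ be a solution concept. Let $\Gamma^f$ be the class of all mechanisms that fully implement $f$ in $\mathcal{S}$. (i) If $f$ is fully implementable in $\mathcal{S}$ and $\mathcal{S}$ satisfies Weak Solution Consistency (WSC) for $\Gamma^f$, then $f$ is Bayesian Incentive Compatible (BIC). (ii) If $f$ is BIC and fully implementable in $\mathcal{S}$, then $\mathcal{S}$ satisfies WSC for $\Gamma^f$.
   Context: Environment. $I$ is the set of agents, $A$ the set of alternatives, $T_i$ the set of types of agent $i$, $T=\times_{i\in I}T_i$, $T_{-i}=\times_{j\neq i}T_j$. The spaces $A$, $T_i$ and all action sets $S_i$ below are separable metrizable with Borel $\sigma$-algebras, and products carry the product topology. Type $t_i$ of agent $i$ has a belief $p_i(\cdot|t_i)\in\Delta(T_{-i})$ with full support. Bernoulli utilities $u_i:A\times T\to\mathbb{R}$ are bounded and continuous; for a lottery $a\in\Delta(A)$, $u_i(a,t)$ denotes expected utility. Social choice functions and mechanisms. A social choice function (SCF) is a measurable $f:T\to\Delta(A)$. A mechanism is a pair $\gamma=(\mu,S)$ with $S=\times_{i\in I}S_i$ and $\mu:S\to\Delta(A)$ measurable; $\Gamma$ is the class of all mechanisms. Given $\gamma$, $\Sigma$ is the set of strategy profiles, i.e. measurable $\sigma:T\to\Delta(S)$; $\Sigma_{-i}$ is the set of measurable $\sigma_{-i}:T_{-i}\to\Delta(S_{-i})$. $\mu(\sigma(t))\in\Delta(A)$ is the lottery induced by $\sigma(t)$ under $\mu$, and $\mu(\sigma)$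 is the SCF $t\mapsto\mu(\sigma(t))$. Solution concepts. An expectation profile for $\gamma$ is $e=(e_i)_{i\in I}$ with $e_i:T_i\to\Sigma_{-i}$, $t_i\mapsto e_{i,t_i}$. A theory of expectations $E$ assigns to each mechanism $\gamma$ a set $E(\gamma)$ of expectation profiles for $\gamma$. A theory of response $R$ assigns to each mechanism $\gamma$ and each $e\in E(\gamma)$ a set $R(e)\subseteq\Sigma$. A solution concept is a pair $\mathcal{S}=(R,E)$; its set of solutions to $\gamma$ is $\mathcal{S}(\gamma)=\bigcup_{e\in E(\gamma)}R(e)$. Full implementation. A mechanism $\gamma=(\mu,S)$ fully implements $f$ in $\mathcal{S}$ if $\{\mu(\sigma):\sigma\in\mathcal{S}(\gamma)\}=\{f\}$ and $R(e)\neq\emptyset$ for all $e\in E(\gamma)$. $f$ is fully implementable in $\mathcal{S}$ if $\Gamma^f\neq\emptyset$. BIC. $f$ is BIC if for all $i\in I$ and $t_i,t_i'\in T_i$, $\int_{T_{-i}}u_i(f(t),t)\,dp_i(t_{-i}|t_i)\geq\int_{T_{-i}}u_i(f(t_i',t_{-i}),t)\,dp_i(t_{-i}|t_i)$, where $t=(t_i,t_{-i})$. WSC. $\mathcal{S}$ satisfies WSC for a class $\tilde\Gamma\subseteq\Gamma$ if for all $\gamma\in\tilde\Gamma$, $i\in I$, $t_i\in T_i$ there exists $\sigma\in\mathcal{S}(\gamma)$ such that for all $t_i'\in T_i$: $\int_{T_{-i}}u_i(\mu(\sigma(t)),t)\,dp_i(t_{-i}|t_i)\geq\int_{T_{-i}}u_i(\mu(\sigma(t_i',t_{-i})),t)\,dp_i(t_{-i}|t_i)$.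 *)

(* Defs.v *)
From HB Require Import structures.
From mathcomp Require Import all_boot all_order all_algebra.
From mathcomp Require Import all_classical all_reals all_analysis.
From mathcomp Require Import measurable_realfun.

Set Implicit Arguments.
Unset Strict Implicit.
Unset Printing Implicit Defensive.

Import Order.TTheory GRing.Theory Num.Theory.
Import numFieldNormedType.Exports.

Local Open Scope classical_set_scope.
Local Open Scope ring_scope.

Definition separable (X : topologicalType) : Prop :=
  exists2 D : set X, countable D & dense D.

Definition metrizable (R : realType) (X : topologicalType) : Prop :=
  exists d : X -> X -> R,
    [/\ forall x, d x x = 0,
        forall x y, d x y = 0 -> x = y,
        forall x y, d x y = d y x,
        forall x y z, d x z <= d x y + d y z &
        forall (x : X) (A : set X),
          nbhs x A <-> exists2 e : R, 0 < e & [set y | d x y < e] `<=` A].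

Definition separable_metrizable (R : realType) (X : topologicalType) : Prop :=
  separable X /\ metrizable R X.

Definition borel (X : ptopologicalType) : measurableType (@open X).-sigma :=
  g_sigma_algebraType (@open X).

(* The sigma-algebra of [pprobability] is the one generated by the evaluations
   [P |-> P B], [B] Borel; on a separable metrizable [X] it is also the Borel
   sigma-algebra of the weak topology. *)
Notation Delta R X := (pprobability (borel X) R).

(* A [probability] of the library is a function on all subsets, with
   unconstrained values on the non-measurable ones, so Leibniz equality is too
   fine: two elements of [Delta R X] are the same lottery when they agree on
   Borel sets. *)
Definition same_law (R : realType) (X : ptopologicalType) (P Q : Delta R X) :=
  forall B : set (borel X), measurable B -> P B = Q B.

Definition law_support (R : realType) (X : ptopologicalType) (P : Delta R X)
  : set X := [set x | forall U : set X, open_nbhs x U -> (0 < P U)%E].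

HB.instance Definition _ (I : Type) (X : I -> ptopologicalType) :=
  Pointed.copy (prod_topology X) (forall i, X i).

Definition profile (I : Type) (X : I -> ptopologicalType) : ptopologicalType :=
  prod_topology X.

Definition profile_minus (I : Type) (X : I -> ptopologicalType) (i : I)
    : ptopologicalType :=
  profile (fun j : {j : I | j <> i} => X (sval j)).

(* [join_profile x y] is [(x, y)], for [x] in [X_i] and [y] in [X_{-i}],
   viewed in the full product. *)
Definition join_profile (I : Type) (X : I -> ptopologicalType) (i : I)
    (x : X i) (y : profile_minus X i) : profile X :=
  fun j => match pselect (j = i) with
           | left e => eq_rect i X x j (esym e)
           | right n => y (exist _ j n)
           end.

Section average_law.
Context (R : realType) (X Y : ptopologicalType).
Context (m : {mfun borel X >-> Delta R Y}) (P : Delta R X).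
Local Open Scope ereal_scope.

Let mK : R.-pker (borel X) ~> (borel Y) :=
  kprobability (measurable_funPT m).

Definition average_fun (B : set (borel Y)) : \bar R :=
  \int[P]_x m x B.

Let average0 : average_fun set0 = 0.
Proof. by rewrite /average_fun integral0_eq// => x _; rewrite measure0. Qed.

Let average_ge0 B : 0 <= average_fun B.
Proof. by rewrite /average_fun integral_ge0. Qed.

Let average_sigma_additive : semi_sigma_additive average_fun.
Proof.
move=> F mF tF _.
have mm k : measurable_fun setT (fun x => m x (F k)).
  exact: (measurable_kernel mK).
rewrite [X in _ --> X](_ : _ =
    \int[P]_x \sum_(0 <= k <oo) m x (F k)); last first.
  apply: eq_integral => x _.
  by apply/esym/cvg_lim => //; exact: measure_sigma_additive.
rewrite [X in X @ _](_ : _ =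
    (fun n => \int[P]_x \sum_(0 <= k < n) m x (F k))); last first.
  by apply/funext => n; rewrite -ge0_integral_sum.
apply: cvg_monotone_convergence => //.
- by move=> n; exact: emeasurable_sum.
- by move=> n x _; rewrite sume_ge0.
- by move=> x _ k n kn; exact: ereal_nondecreasing_series.
Qed.

HB.instance Definition _ := isMeasure.Build _ _ R average_fun
  average0 average_ge0 average_sigma_additive.

Let averageT : average_fun setT = 1.
Proof.
rewrite /average_fun (eq_integral (cst 1)); last first.
  by move=> x _; exact: (@probability_setT _ _ R (m x)).
by rewrite integral_cst// mul1e; exact: (@probability_setT _ _ R P).
Qed.

HB.instance Definition _ :=
  Measure_isProbability.Build _ _ _ average_fun averageT.

Definition average_law : Delta R Y := average_fun.

End average_law.

Section average_mfun.
Context (R : realType) (X Y Z : ptopologicalType).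
Context (m : {mfun borel X >-> Delta R Y}) (s : {mfun borel Z >-> Delta R X}).

Definition average_mfun (z : borel Z) : Delta R Y := average_law m (s z).

Let measurable_average_mfun : measurable_fun setT average_mfun.
Proof.
apply: (measurability (@pset _ _ _ : set (set (Delta R Y)))) => //.
move=> _ -[_ [r _] [B mB <-]] <-.
apply: emeasurable_fun_infty_o => //.
apply: (@measurable_fun_integral_kernel _ _ _ _ _
          (kprobability (measurable_funPT s)) _ (fun x => m x B)) => //.
- exact: measurable_kernel.
- exact: (measurable_kernel (kprobability (measurable_funPT m))).
Qed.

HB.instance Definition _ :=
  isMeasurableFun.Build _ _ _ _ average_mfun measurable_average_mfun.

End average_mfun.

(* The distinguished points of the spaces below only witness nonemptiness. *)
Record environment (R : realType) := Environment {
  agent : Type;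
  alternative : ptopologicalType;
  type_space : agent -> ptopologicalType;
  belief : forall i, type_space i -> Delta R (profile_minus type_space i);
  utility : agent -> alternative * profile type_space -> R;
  alternative_sm : separable_metrizable R alternative;
  type_sm : forall i, separable_metrizable R (type_space i);
  belief_full_support : forall i (ti : type_space i), law_support (belief ti) = setT;
  utility_continuous : forall i, continuous (utility i);
  utility_bounded :
    forall i, exists M : R, forall x, `|utility i x| <= M }.

Section implementation.
Context (R : realType) (Env : environment R).

Local Notation I := (agent Env).
Local Notation A := (alternative Env).
Local Notation T := (profile (@type_space R Env)).
Local Notation T_minus := (profile_minus (@type_space R Env)).

Definition expected_utility (i : I) (a : Delta R A) (t : T) : R :=
  \int[a]_x utility i (x, t).

Definition scf := {mfun borel T >-> Delta R A}.

Definition same_scf (f g : scf) : Prop := forall t, same_law (f t) (g t).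

(* Expected utility of type [ti] of agent [i] when [f] is applied as if the
   type of agent [i] were [ti']. *)
Definition interim_utility (f : scf) (i : I) (ti ti' : type_space i) : R :=
  \int[belief ti]_y
    expected_utility i (f (join_profile ti' y)) (join_profile ti y).

Definition BIC (f : scf) : Prop :=
  forall (i : I) (ti ti' : type_space i),
    interim_utility f ti ti' <= interim_utility f ti ti.

Record mechanism := Mechanism {
  action : I -> ptopologicalType;
  action_sm : forall i, separable_metrizable R (action i);
  outcome : {mfun borel (profile action) >-> Delta R A} }.

Definition strategy (g : mechanism) :=
  {mfun borel T >-> Delta R (profile (action g))}.

Definition strategy_minus (g : mechanism) (i : I) :=
  {mfun borel (T_minus i) >-> Delta R (profile_minus (action g) i)}.

Definition induced_scf (g : mechanism) (s : strategy g) : scf :=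
  average_mfun (outcome g) s.

Definition expectation_profile (g : mechanism) :=
  forall i : I, type_space i -> strategy_minus g i.

Definition theory_of_expectations :=
  forall g : mechanism, set (expectation_profile g).

Definition theory_of_response (E : theory_of_expectations) :=
  forall (g : mechanism) (e : expectation_profile g), E g e -> set (strategy g).

Record solution_concept := SolutionConcept {
  expectations : theory_of_expectations;
  responses : theory_of_response expectations }.

Definition solutions (S : solution_concept) (g : mechanism)
    : set (strategy g) :=
  [set s | exists (e : expectation_profile g) (he : expectations S e),
             responses he s].

(* The first conjunct is the equality of sets {mu(s) : s in S(g)} = {f}, read
   up to [same_scf]. *)
Definition fully_implements (S : solution_concept) (f : scf) (g : mechanism)
    : Prop :=
  (forall h : scf,
     (exists2 s : strategy g, solutions S s & same_scf (induced_scf s) h) <-> same_scf h f)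
  /\ (forall (e : expectation_profile g) (he : expectations S e),
        responses he !=set0).

Definition implementing_mechanisms (S : solution_concept) (f : scf)
    : mechanism -> Prop := fun g => fully_implements S f g.

Definition fully_implementable (S : solution_concept) (f : scf) : Prop :=
  exists g, implementing_mechanisms S f g.

Definition WSC (S : solution_concept) (G : mechanism -> Prop) : Prop :=
  forall g, G g -> forall (i : I) (ti : type_space i),
    exists2 s : strategy g, solutions S s &
      forall ti' : type_space i,
        interim_utility (induced_scf s) ti ti'
          <= interim_utility (induced_scf s) ti ti.

End implementation.

(* Main.v *)
Require Import Defs.
From mathcomp Require Import all_boot all_order all_algebra.
From mathcomp Require Import all_classical all_reals all_analysis.

(** If [g] fully implements [f], every solution to [g] induces [f] up to [same_scf], and interim
    utilities do not distinguish such functions. So the WSC inequalities at any solution to [g] are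
    the BIC inequalities of [f]. Part (i) reads them off at one implementing mechanism; part (ii)
    transfers them to some solution of each. *)

(** Integrals see a measure only through its values on measurable sets, so junk values off the Borel
    sets are harmless. *)
Lemma same_law_Rintegral (R : realType) (X : ptopologicalType)
    (P Q : Delta R X) (g : X -> R) :
  same_law P Q -> Rintegral P setT g = Rintegral Q setT g.
Proof.
move=> PQ; congr fine; apply: eq_measure_integral => B mB _.
exact: PQ.
Qed.

Lemma same_scf_interim_utility (R : realType) (Env : environment R)
    (f h : scf Env) (i : agent Env) (ti ti' : type_space i) :
  same_scf f h -> interim_utility f ti ti' = interim_utility h ti ti'.
Proof.
move=> fh; apply: eq_Rintegral => y _.
exact: same_law_Rintegral.
Qed.

Lemma solution_same_scf (R : realType) (Env : environment R)
    (f : scf Env) (S : solution_concept Env) (g : mechanism Env)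
    (s : strategy g) :
  fully_implements S f g -> solutions S s -> same_scf (induced_scf s) f.
Proof. by move=> [outcomes _] Ss; apply/outcomes; exists s. Qed.

(** Solutions exist because {f} is nonempty: take [h := f] in the set equality. *)
Lemma fully_implements_solution (R : realType) (Env : environment R)
    (f : scf Env) (S : solution_concept Env) (g : mechanism Env) :
  fully_implements S f g ->
  exists2 s : strategy g, solutions S s & same_scf (induced_scf s) f.
Proof. by move=> [outcomes _]; apply/outcomes. Qed.

Theorem theorem1 (R : realType) (Env : environment R)
    (f : scf Env) (S : solution_concept Env) :
  (fully_implementable S f -> WSC S (implementing_mechanisms S f) -> BIC f) /\
  (BIC f -> fully_implementable S f -> WSC S (implementing_mechanisms S f)).
Proof.
split=> [[g gf] wsc i ti ti'|bic _ g gf i ti].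
  have [s Ss s_opt] := wsc g gf i ti.
  have sf := solution_same_scf _ _ _ _ _ _ gf Ss.
  by rewrite -!(same_scf_interim_utility _ _ _ _ _ _ _ sf).
(* Any solution will do, the same one for all [i] and [ti]. *)
have [s Ss sf] := fully_implements_solution _ _ _ _ _ gf.
exists s => [|ti']; first exact: Ss.
have sfE := same_scf_interim_utility _ _ _ _ _ _ _ sf.
rewrite (sfE i ti ti') (sfE i ti ti).
exact: bic.
Qed.
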